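(* Let $\vec G$ be a tree graph or a cycle graph with $n$ vertices and let $D=D_{\vec G}$ be its incidence matrix. Let $S\in\mathcal{S}(D_{\vec G})$ be arbitrary (with $S\neq\emptyset$ if $\vec G$ is a cycle graph) and let $x,t>0$. Choose $\lambda\ge\sigma\sqrt{n_{\max}(\log(2n)+t)}/n$. Then for all $f\in\mathbb{R}^n$, with probability at least $1-e^{-x}-e^{-t}$, $$\|\hat f-f^0\|_n^2\le\|f-f^0\|_n^2+\frac{\sigma^2}{n}\left(\sqrt{2x}+\sqrt{r_S}\right)^2+4\,\frac{\sigma}{n}\sqrt{n_{\max}(\log(2n)+t)}\,\|Df\|_1 .$$
   Context: Model: $f^0\in\mathbb{R}^n$ is a fixed signal and one observes $Y=f^0+\epsilon$ with $\epsilon\sim\mathcal{N}_n(0,\sigma^2 \mathrm{I}_n)$, $\sigma\in(0,\infty)$. For $f\in\mathbb{R}^n$, $\|f\|_n^2=\sum_{i=1}^n f_i^2/n$. The total variation regularized estimator is $\hat f=\arg\min_{f\in\mathbb{R}^n}\{\|Y-f\|_n^2+2\lambda\|Df\|_1\}$, $\lambda>0$. The incidence matrix of a directed graph $\vec G=([n],\{e_1,\dots,e_m\})$ with edges $e_i=(e_i^-,e_i^+)$ is the matrix $D_{\vec G}\in\{-1,0,1\}^{m\times n}$ whose $i$-th row $d_i'$ has entry $-1$ at $e_i^-$, $+1$ at $e_i^+$ and $0$ elsewhere. A tree graph is a connected graph with $n-1$ edges; the cycle graph is $([n],\{(1,2),\dots,(n-1,n),(n,1)\})$. For $S\subseteq[m]$: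 $-S=[m]\setminus S$; $D_{-S}$ is the submatrix of rows indexed by $-S$. $\mathcal{S}(D)=\{S\subseteq[m]:\exists f\in\mathbb{R}^n,\ S=\{j:d_j'f\ne0\}\}$. $r_S=\dim\mathcal{N}(D_{-S})$ (dimension of the nullspace), which equals the number of connected components of the graph $\vec G_{-S}$ obtained by removing the edges $e_i$, $i\in S$. $n_1,\dots,n_{r_S}$ are the numbers of vertices of these components and $n_{\max}$ is their maximum.
   Formalization: The last term is 4λ‖Df‖₁ instead of 4(σ/n)√(n_max(log(2n)+t))‖Df‖₁; the two agree at the smallest admissible λ, and the printed bound fails for large λ (n=2 tree, S=∅, f=f⁰=(0,M), M large). *)

(* Defs.v *)
From HB Require Import structures.
From mathcomp Require Import all_boot all_order all_algebra.
From mathcomp Require Import all_classical all_reals all_analysis.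

Set Implicit Arguments.
Unset Strict Implicit.
Unset Printing Implicit Defensive.

Import Order.TTheory GRing.Theory Num.Theory.
Import numFieldNormedType.Exports.

Local Open Scope classical_set_scope.
Local Open Scope ring_scope.

(* The vertex set [n] = {1, ..., n} is represented by 'I_n = {0, ..., n - 1};
   edge i = (tail, head) = (e_i^-, e_i^+). *)
Record digraph (n m : nat) := Digraph {
  edge :> 'I_m -> 'I_n * 'I_n;
  edge_inj : injective edge;
  edge_loopless : forall i, (edge i).1 != (edge i).2
}.

Definition incidence (R : realType) n m (G : digraph n m) : 'M[R]_(m, n) :=
  \matrix_(i, j) (if j == (G i).1 then -1 else if j == (G i).2 then 1 else 0).

(* Adjacency, ignoring orientations, in the graph without the edges of S. *)
Definition adj n m (G : digraph n m) (S : {set 'I_m}) : rel 'I_n :=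
  fun u v => [exists i, (i \notin S) && ((G i == (u, v)) || (G i == (v, u)))].

Definition components n m (G : digraph n m) (S : {set 'I_m}) :
    {set {set 'I_n}} :=
  equivalence_partition (connect (adj G S)) [set: 'I_n].

Definition n_max n m (G : digraph n m) (S : {set 'I_m}) : nat :=
  \max_(C in components G S) #|C|.

Definition connected_graph n m (G : digraph n m) : Prop :=
  forall u v : 'I_n, connect (adj G finset.set0) u v.

(* m = n - 1, without truncated subtraction; in particular n >= 1. *)
Definition tree_graph n m (G : digraph n m) : Prop :=
  connected_graph G /\ n = m.+1.

(* The edge set is {(v, v + 1 mod n) : v}, in any enumeration; [ordS] is the
   cyclic successor.  Since G is loopless and has no repeated edge, m = n and
   n is not 1. *)
Definition cycle_graph n m (G : digraph n m) : Prop :=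
  forall u v : 'I_n, (exists i, G i = (u, v)) <-> v = ordS u.

(* D_{-S} *)
Definition rows_outside (R : realType) m n (D : 'M[R]_(m, n))
    (S : {set 'I_m}) : 'M[R]_(#|~: S|, n) :=
  rowsub (fun k => enum_val k) D.

(* [kermx] is a left kernel: the rows of kermx (D_{-S})^T span the transposes
   of the solutions f of D_{-S} f = 0. *)
Definition r_S (R : realType) m n (D : 'M[R]_(m, n)) (S : {set 'I_m}) : nat :=
  \rank (kermx (rows_outside D S)^T).

(* S belongs to the family of sets written S(D). *)
Definition is_support (R : realType) m n (D : 'M[R]_(m, n))
    (S : {set 'I_m}) : Prop :=
  exists f : 'cV[R]_n, forall j, (j \in S) = ((D *m f) j 0 != 0).

(* ||f||_n^2 *)
Definition sqnorm_n (R : realType) n (f : 'cV[R]_n) : R :=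
  (\sum_i f i 0 ^+ 2) / n%:R.

Definition norm1 (R : realType) m (u : 'cV[R]_m) : R := \sum_j `|u j 0|.

Definition tv_objective (R : realType) m n (D : 'M[R]_(m, n)) (lambda : R)
    (y f : 'cV[R]_n) : R :=
  sqnorm_n (y - f) + 2 * lambda * norm1 (D *m f).

Definition tv_argmin (R : realType) m n (D : 'M[R]_(m, n)) (lambda : R)
    (y fhat : 'cV[R]_n) : Prop :=
  forall f, tv_objective D lambda y fhat <= tv_objective D lambda y f.

(* eps ~ N_n(0, sigma^2 I_n): the joint law of the coordinates is the n-fold
   product of N(0, sigma^2).  The second parameter of [normal_prob] is the
   standard deviation. *)
Definition white_noise (R : realType) (d : measure_display)
    (T : measurableType d) (P : probability T R) n
    (eps : 'I_n -> {RV P >-> R}) (sigma : R) : Prop :=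
  forall A : 'I_n -> set R, (forall i, measurable (A i)) ->
  P [set w | forall i, A i (eps i w)] =
  (\prod_(i < n) normal_prob 0 sigma (A i))%E.

Definition observation (R : realType) (d : measure_display)
    (T : measurableType d) (P : probability T R) n
    (f0 : 'cV[R]_n) (eps : 'I_n -> {RV P >-> R}) (w : T) : 'cV[R]_n :=
  f0 + \col_i eps i w.

(* Main.v *)
Require Import Defs.
From HB Require Import structures.
From mathcomp Require Import all_boot all_order all_algebra.
From mathcomp Require Import ring lra zify.
From mathcomp Require Import all_classical all_reals all_analysis.
From mathcomp Require Import measurable_realfun.
Set Implicit Arguments.
Unset Strict Implicit.
Unset Printing Implicit Defensive.
Import Order.TTheory GRing.Theory Num.Theory.
Import numFieldNormedType.Exports.
Local Open Scope classical_set_scope.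
Local Open Scope ring_scope.

(** The oracle inequality is deterministic on an event of large probability.

    Since the objective is a squared norm plus a convex function, the minimizer
    fhat beats every competitor f by the extra margin |fhat - f|^2
    ([tv_argmin_strong]).  Expanding the squares with g = fhat - f leaves
      |fhat - f0|^2 + |g|^2
        <= |f - f0|^2 + 2 <eps, g> + 2 n lambda (|D f|_1 - |D fhat|_1),
    so everything rests on bounding 2 <eps, g>.

    In a tree, or in a cycle with at least one edge removed, the edges outside S
    form a forest.  Hence each edge j outside S disconnects its component, and
    the vector v_j equal to +-1/2 on the two sides and to 0 elsewhere satisfies
    D_(-S) v_j = e_j and |v_j|^2 <= n_max / 4.  The normalized indicators u_C of
    the components form an orthonormal basis of the kernel of D_(-S); subtracting
    from v_j its projection on that kernel gives a vector z_j which is not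
    longer, and every g decomposes as
      g = sum_C <u_C, g> u_C + sum_(j notin S) (D g)_j z_j
    ([component_edge_decomposition]).  The kernel part of 2 <eps, g> is at most
    sum_C <u_C, eps>^2 + |g|^2, and |g|^2 is absorbed by the margin; the edge part
    is at most 2 max_j |<z_j, eps>| (|D fhat|_1 + |D f|_1), which is absorbed as
    soon as all |<z_j, eps>| are at most n lambda ([tv_oracle_inequality]).

    Two tail bounds remain.  Each <z_j, eps> is a centred Gaussian of variance at
    most sigma^2 n_max / 4, and a union bound over the edges costs exp (- t).  The
    sum of the <u_C, eps>^2 is sigma^2 times a chi-square variable with as many
    degrees of freedom as there are components.  Its exponential moments are
    computed without rotating the noise: exp (s a^2) is the average of
    exp (sqrt (2 s) a eta) over a standard Gaussian eta, which reduces them by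
    Tonelli, one orthonormal vector at a time, to those of linear forms
    ([gaussian_chi2_mgf]); Chernoff's bound then gives exp (- x)
    ([gaussian_chi2_tail]).

    The probability of the event in the conclusion is compared with that of the
    good event, so the event has to be measurable: a vector is close to the
    minimizer as soon as it nearly minimizes the objective among the countably
    many rational vectors ([tv_argmin_measurable]). *)

(** * Inner products and orthonormal families *)

Definition dot (R : realType) (n : nat) (a b : 'cV[R]_n) : R :=
  \sum_i a i 0 * b i 0.

Section Dot.
Context (R : realType) (n : nat).
Implicit Types a b c : 'cV[R]_n.

Lemma dotC a b : dot a b = dot b a.
Proof. by apply: eq_bigr => i _; rewrite mulrC. Qed.

Lemma dotDr a b c : dot a (b + c) = dot a b + dot a c.
Proof. by rewrite /dot -big_split; apply: eq_bigr => i _; rewrite mxE mulrDr. Qed.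

Lemma dotZr k a b : dot a (k *: b) = k * dot a b.
Proof. by rewrite /dot mulr_sumr; apply: eq_bigr => i _; rewrite mxE mulrCA. Qed.

Lemma dotDl a b c : dot (b + c) a = dot b a + dot c a.
Proof. by rewrite dotC dotDr !(dotC a). Qed.

Lemma dotZl k a b : dot (k *: b) a = k * dot b a.
Proof. by rewrite dotC dotZr dotC. Qed.

Lemma dotNr a b : dot a (- b) = - dot a b.
Proof. by rewrite -scaleN1r dotZr mulN1r. Qed.

Lemma dotBr a b c : dot a (b - c) = dot a b - dot a c.
Proof. by rewrite dotDr dotNr. Qed.

Lemma dotBl a b c : dot (b - c) a = dot b a - dot c a.
Proof. by rewrite dotC dotBr !(dotC a). Qed.

Lemma dot_sumr I (r : seq I) (Q : pred I) a (F : I -> 'cV[R]_n) :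
  dot a (\sum_(i <- r | Q i) F i) = \sum_(i <- r | Q i) dot a (F i).
Proof.
elim/big_rec2: _ => [|i x y _ <-]; last by rewrite dotDr.
by rewrite -(scale0r 0) dotZr mul0r.
Qed.

Lemma dotNl a b : dot (- b) a = - dot b a.
Proof. by rewrite dotC dotNr dotC. Qed.

Lemma dot0 a : dot 0 a = 0.
Proof. by rewrite -(scale0r 0) dotZl mul0r. Qed.

Lemma dot_ge0 a : 0 <= dot a a.
Proof. by apply: sumr_ge0 => i _; rewrite -expr2 sqr_ge0. Qed.

End Dot.

Section Projection.
Context (R : realType) (n : nat) (I : finType) (A : {set I}) (u : I -> 'cV[R]_n).
Hypothesis orth : {in A &, forall k l, dot (u k) (u l) = (k == l)%:R}.

(** The component of [v] orthogonal to the span of the orthonormal family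
    [u k], [k \in A]. *)
Definition residual (v : 'cV[R]_n) : 'cV[R]_n :=
  v - \sum_(k in A) dot (u k) v *: u k.

Lemma dot_residual v :
  dot (residual v) (residual v) = dot v v - \sum_(k in A) dot (u k) v ^+ 2.
Proof.
have uk k : k \in A -> dot (u k) (residual v) = 0.
  move=> kA; rewrite dotBr dot_sumr (bigD1 k) //= dotZr orth // eqxx mulr1.
  rewrite big1 ?addr0 ?subrr // => l /andP[lA lk].
  by rewrite dotZr orth // eq_sym (negbTE lk) mulr0.
rewrite {1}/residual dotBl [X in _ - X]dotC dot_sumr big1 ?subr0; last first.
  by move=> k kA; rewrite dotZr (dotC (residual v)) uk // mulr0.
rewrite dotBr dot_sumr; congr (_ - _); apply: eq_bigr => k kA.
by rewrite dotZr (dotC v) expr2.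
Qed.

Lemma bessel v : \sum_(k in A) dot (u k) v ^+ 2 <= dot v v.
Proof. by rewrite -subr_ge0 -dot_residual dot_ge0. Qed.

Lemma dot_residual_le v : dot (residual v) (residual v) <= dot v v.
Proof.
by rewrite dot_residual lerBlDr lerDl; apply: sumr_ge0 => k _; exact: sqr_ge0.
Qed.

Lemma residualB v w : residual (v - w) = residual v - residual w.
Proof.
rewrite /residual.
have -> : \sum_(k in A) dot (u k) (v - w) *: u k =
    \sum_(k in A) dot (u k) v *: u k - \sum_(k in A) dot (u k) w *: u k.
  by rewrite -sumrB; apply: eq_bigr => k _; rewrite dotBr scalerBl.
by rewrite !opprB addrACA [RHS]addrACA; congr (_ + _); rewrite addrC.
Qed.

Lemma residual_sum J (r : seq J) (Q : pred J) (c : J -> R) (v : J -> 'cV[R]_n) :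
  residual (\sum_(j <- r | Q j) c j *: v j)
  = \sum_(j <- r | Q j) c j *: residual (v j).
Proof.
rewrite /residual; under [RHS]eq_bigr do rewrite scalerBr.
rewrite sumrB; congr (_ - _).
under [RHS]eq_bigr do rewrite scaler_sumr.
rewrite exchange_big /=; apply: eq_bigr => k _.
rewrite dot_sumr scaler_suml; apply: eq_bigr => j _.
by rewrite dotZr scalerA.
Qed.

End Projection.

(** * Graphs whose remaining edges form a forest *)

Lemma connect_invariant (T : finType) (U : Type) (e : rel T) (f : T -> U) :
  (forall x y, e x y -> f x = f y) -> forall x y, connect e x y -> f x = f y.
Proof.
move=> ef x y /connectP[p]; elim: p x => [x _ -> //|z p IH x /= /andP[xz pz] yE].
by rewrite (ef _ _ xz); exact: IH.
Qed.

Section Incidence.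
Context (R : realType) (n m : nat) (G : digraph n m).
Implicit Types (f p : 'cV[R]_n) (S : {set 'I_m}).

Lemma incidence_mulE f j :
  (incidence R G *m f) j 0 = f (G j).2 0 - f (G j).1 0.
Proof.
have ht : (G j).2 != (G j).1 by rewrite eq_sym edge_loopless.
rewrite mxE (bigD1 (G j).1) //= (bigD1 (G j).2) //= big1 => [|i /andP[it ih]].
  by rewrite !mxE eqxx (negbTE ht) eqxx mulN1r mul1r addr0 addrC.
by rewrite mxE (negbTE it) (negbTE ih) mul0r.
Qed.

Lemma adj_sym S : symmetric (adj G S).
Proof. by move=> u v; apply: eq_existsb => i; rewrite orbC. Qed.

Lemma adj_edge S j : j \notin S -> adj G S (G j).1 (G j).2.
Proof.
by move=> jS; apply/existsP; exists j; rewrite jS -surjective_pairing eqxx.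
Qed.

Lemma adj_invariant (U : Type) S (f : 'I_n -> U) :
  (forall j, j \notin S -> f (G j).2 = f (G j).1) ->
  forall u v, connect (adj G S) u v -> f u = f v.
Proof.
move=> fS; apply: connect_invariant => u v /existsP[j /andP[jS]].
by case/orP => /eqP Gj; have := fS j jS; rewrite Gj.
Qed.

(** The rows of D_(-S) are linearly independent, stated as the existence of
    preimages of the unit vectors: this is the form in which the forest property
    of the graph without [S] is used, and it covers trees and cut cycles at
    once. *)
Definition independent_edges S := forall j, j \notin S ->
  exists p : 'cV[R]_n, forall k, k \notin S ->
    p (G k).2 0 - p (G k).1 0 = (k == j)%:R.

(** A connected graph has a one-dimensional kernel, so on n - 1 edges its
    incidence matrix has full row rank, and a right inverse provides the
    potentials. *)
Lemma tree_independent_edges S : tree_graph G -> independent_edges S.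
Proof.
move=> [conn nm] j _.
have rk1 : (\rank (kermx (incidence R G)^T) <= 1)%N.
  have v0 : 'I_n by rewrite nm; exact: ord0.
  set K := kermx _.
  (* A row of [K] is a vector without differences along the edges. *)
  have Kconst i v : K i v = K i v0.
    have : incidence R G *m (row i K)^T = 0.
      by apply: trmx_inj; rewrite trmx_mul trmxK -row_mul mulmx_ker trmx0 row0.
    move=> DK.
    have := @adj_invariant _ finset.set0 (fun u => K i u) _ v v0 (conn _ _).
    apply => k _; have := congr1 (fun M : 'cV_m => M k 0) DK.
    by rewrite incidence_mulE !mxE => /eqP; rewrite subr_eq0 => /eqP.
  have -> : K = (\col_i K i v0) *m (const_mx 1 : 'rV_n).
    apply/matrixP => i v.
    rewrite [RHS]mxE big_ord1 [X in X * _]mxE [X in _ * X]mxE mulr1.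
    exact: Kconst.
  exact: leq_trans (mxrankM_maxr _ _) (rank_leq_row _).
have /row_freeP[B DB] : row_free (incidence R G).
  rewrite /row_free eqn_leq rank_leq_row /=.
  by move: rk1; rewrite mxrank_ker mxrank_tr leq_subLR {1}nm addn1 ltnS.
by exists (col j B) => k _; rewrite -incidence_mulE colE mulmxA -colE DB !mxE.
Qed.

(** Potentials of the cycle can only be found for pairs of edges, since the
    differences along the cycle sum to zero: the potential for [j] rises by one
    along [j] and falls by one along a removed edge [s]. *)
Lemma cycle_independent_edges S :
  cycle_graph G -> S != finset.set0 -> independent_edges S.
Proof.
move=> cyc /set0Pn[s sS] j jS.
have GE k : (G k).2 = ordS (G k).1.
  by apply/cyc; exists k; rewrite -surjective_pairing.
(* Along the edge that closes the cycle [step u] drops by 1, unless [u] is the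
   last vertex; this drop cancels in the difference of two steps. *)
pose step (u i : 'I_n) : R := (val u < val i)%N%:R.
have stepE u a :
    step u (ordS a) - step u a = (a == u)%:R - (nat_of_ord a == n.-1)%:R.
  have ua : (u < n)%N && (a < n)%N by rewrite !ltn_ord.
  rewrite /step /= -(inj_eq val_inj) /=; case/andP: ua => un an.
  have [an1|an1] := ltnP a.+1 n.
    rewrite modn_small // ltnS (_ : (nat_of_ord a == n.-1) = false) ?subr0;
      last by lia.
    by case: (ltngtP u a) => ua; rewrite ?subrr ?subr0 ?sub0r.
  have -> : a.+1 = n by lia.
  rewrite modnn ltn0 (_ : (nat_of_ord a == n.-1)) /=; last by lia.
  have [->|au] := eqVneq (nat_of_ord a) u; first by rewrite ltnn !subrr.
  by rewrite (_ : (u < a)%N) //; lia.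
exists (\col_i (step (G j).1 i - step (G s).1 i)) => k kS.
have GI a b : ((G a).1 == (G b).1) = (a == b).
  apply/eqP/eqP => [ab|-> //]; apply: (edge_inj (d := G)).
  by rewrite [G a]surjective_pairing [G b]surjective_pairing !GE ab.
have := stepE (G j).1 (G k).1; have := stepE (G s).1 (G k).1.
rewrite !mxE GE !GI (_ : (k == s) = false); last first.
  by apply: contraNF kS => /eqP ->.
move=> Es Ej; transitivity ((step (G j).1 (ordS (G k).1) - step (G j).1 (G k).1)
  - (step (G s).1 (ordS (G k).1) - step (G s).1 (G k).1)); first by ring.
by rewrite Ej Es /=; ring.
Qed.

(** A potential [p] for the edge [j] takes exactly two values on the component
    of [j], namely [p (tail j)] and one more; centring them at 0 and cutting off
    the other components gives the values +-1/2, hence the squared norm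
    (size of the component) / 4. *)
Definition side_vector S (j : 'I_m) (p : 'cV[R]_n) : 'cV[R]_n :=
  \col_i (if connect (adj G S) (G j).1 i then p i 0 - p (G j).1 0 - 1 / 2 else 0).

Lemma card_component_le S u :
  (#|[set v | connect (adj G S) u v]%SET| <= n_max G S)%N.
Proof.
apply: (@leq_bigmax_cond _ _ (fun C : {set 'I_n} => #|C|)).
apply/imsetP; exists u; rewrite ?finset.inE //.
by apply/setP => v; rewrite !finset.inE.
Qed.

Lemma side_vector_edge S j (p : 'cV[R]_n) : j \notin S ->
  (forall k, k \notin S -> p (G k).2 0 - p (G k).1 0 = (k == j)%:R) ->
  forall k, k \notin S ->
    (incidence R G *m side_vector S j p) k 0 = (k == j)%:R.
Proof.
move=> jS pS k kS; rewrite incidence_mulE !mxE.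
have -> : connect (adj G S) (G j).1 (G k).2 = connect (adj G S) (G j).1 (G k).1.
  apply: same_connect1r; first exact/sym_connect_sym/adj_sym.
  by rewrite adj_sym adj_edge.
case: ifPn => [_|nc]; first by rewrite -pS //; ring.
have [kj|] := eqVneq k j; last by rewrite subrr.
by rewrite kj connect0 in nc.
Qed.

Lemma side_vector_norm S j (p : 'cV[R]_n) : j \notin S ->
  (forall k, k \notin S -> p (G k).2 0 - p (G k).1 0 = (k == j)%:R) ->
  dot (side_vector S j p) (side_vector S j p) <= (n_max G S)%:R / 4.
Proof.
move=> jS pS; set a := p (G j).1 0.
(* The property of having one of the two values is invariant along edges. *)
have two v : connect (adj G S) (G j).1 v -> p v 0 = a \/ p v 0 = a + 1.
  move=> jv.
  have E := @adj_invariant _ S (fun u => `[< p u 0 = a \/ p u 0 = a + 1 >]).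
  apply/asboolP; rewrite -(E _ _ _ jv); first by apply/asboolP; left.
  move=> k kS; have := pS k kS; have [->|_] := eqVneq k j; rewrite -/a.
    move=> /= /eqP; rewrite subr_eq addrC => /eqP ->.
    by apply/asboolP/asboolP => _; [left|right].
  by move=> /= /eqP; rewrite subr_eq add0r => /eqP ->.
apply: (@le_trans _ _ (\sum_(v | connect (adj G S) (G j).1 v) 1 / 4)).
  rewrite [X in _ <= X]big_mkcond; apply: ler_sum => v _.
  rewrite !mxE; case: ifP => [/two|_]; last by rewrite mul0r.
  by rewrite -/a => -[] ->; rewrite le_eqVlt; apply/orP; left; apply/eqP; field.
rewrite sumr_const -[(1 / 4) *+ _]mulr_natl [1 / 4]mul1r.
rewrite ler_wpM2r ?invr_ge0 // ler_nat.
apply: leq_trans (card_component_le S (G j).1).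
by rewrite cardsE.
Qed.

End Incidence.

Section Components.
Context (R : realType) (n m : nat) (G : digraph n m) (S : {set 'I_m}).

Lemma connect_adj_equiv :
  {in finset.setT & &, equivalence_rel (connect (adj G S))}.
Proof.
move=> u v w _ _ _; split; first exact: connect0.
move=> uv; apply: same_connect => //; exact/sym_connect_sym/adj_sym.
Qed.

Lemma components_partition : finset.partition (components G S) finset.setT.
Proof. exact: equivalence_partitionP connect_adj_equiv. Qed.

Lemma components_disjoint C C' i :
  C \in components G S -> C' \in components G S ->
  i \in C -> i \in C' -> C = C'.
Proof.
have /and3P[_ tI _] := components_partition.
by move=> CP C'P iC iC'; rewrite -(def_pblock tI CP iC) (def_pblock tI C'P iC').
Qed.

Lemma components_connect C i v : C \in components G S -> i \in C ->
  (v \in C) = connect (adj G S) i v.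
Proof.
move=> CP iC; have /and3P[_ tI _] := components_partition.
rewrite -(def_pblock tI CP iC) /components.
by rewrite (pblock_equivalence_partition connect_adj_equiv) // finset.inE.
Qed.

Definition component_vector (C : {set 'I_n}) : 'cV[R]_n :=
  \col_i (if i \in C then (Num.sqrt #|C|%:R)^-1 else 0).

Local Notation u := component_vector.

Lemma dot_component C f :
  dot (u C) f = (Num.sqrt #|C|%:R)^-1 * \sum_(i in C) f i 0.
Proof.
rewrite /dot mulr_sumr [RHS]big_mkcond; apply: eq_bigr => i _.
by rewrite mxE; case: ifP; rewrite ?mul0r.
Qed.

Lemma component_orthonormal :
  {in components G S &, forall C C', dot (u C) (u C') = (C == C')%:R}.
Proof.
move=> C C' CP C'P; have [<-|CC'] := eqVneq C C'.
  have C0 : (0 < #|C|)%N.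
    rewrite card_gt0; apply/eqP => C0.
    by have /and3P[_ _] := components_partition; rewrite -C0 CP.
  rewrite dot_component (eq_bigr (fun=> (Num.sqrt #|C|%:R)^-1)); last first.
    by move=> i iC; rewrite mxE iC.
  rewrite sumr_const -[(Num.sqrt _)^-1 *+ _]mulr_natr mulrA -expr2 exprVn.
  rewrite sqr_sqrtr //.
  by rewrite mulVf // pnatr_eq0 -lt0n.
rewrite /dot big1 // => i _; rewrite !mxE.
case: ifP => iC; rewrite ?mul0r //; case: ifP => iC'; rewrite ?mulr0 //.
by case/eqP: CC'; exact: components_disjoint iC iC'.
Qed.

Lemma component_vector_constant C k : C \in components G S -> k \notin S ->
  (u C) (G k).2 0 = (u C) (G k).1 0.
Proof.
move=> CP kS; rewrite !mxE; congr (if _ then _ else _).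
apply/idP/idP => iC; rewrite (components_connect _ CP iC) connect1 //.
  by rewrite adj_sym adj_edge.
by rewrite adj_edge.
Qed.

(** A vector constant on components is its own projection: at a vertex [i] only
    the component of [i] contributes, with the mean of [h] over it. *)
Lemma component_expansion (h : 'cV[R]_n) :
  (forall k, k \notin S -> h (G k).2 0 = h (G k).1 0) ->
  h = \sum_(C in components G S) dot (u C) h *: u C.
Proof.
move=> hS; apply/matrixP => i c; rewrite {c}(ord1 c).
have /and3P[/eqP cov tI set0P] := components_partition.
set C0 := finset.pblock (components G S) i.
have icov : i \in finset.cover (components G S) by rewrite cov finset.inE.
have C0P : C0 \in components G S by rewrite finset.pblock_mem.
have iC0 : i \in C0 by rewrite finset.mem_pblock.
rewrite summxE (bigD1 C0) //= big1 ?addr0 => [|C /andP[CP CC0]]; last first.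
  rewrite !mxE; case: ifP => iC; rewrite ?mulr0 //.
  by case/eqP: CC0; exact: components_disjoint iC iC0.
rewrite mxE dot_component mxE iC0 (eq_bigr (fun=> h i 0)); last first.
  move=> v; rewrite (components_connect _ C0P iC0) => iv.
  exact/esym/(@adj_invariant _ _ G _ S (fun v => h v 0) hS _ _ iv).
rewrite sumr_const -[h i 0 *+ _]mulr_natr.
have c0 : 0 < #|C0|%:R :> R by rewrite ltr0n card_gt0; apply/set0Pn; exists i.
rewrite -[X in h i 0 * X](sqr_sqrtr (ltW c0)); field.
by rewrite sqrtr_eq0 -ltNge.
Qed.

(** The vectors [u C] are independent elements of the kernel of D_(-S).  Through
    this inequality r_S replaces the number of components, the true number of
    degrees of freedom, in a bound that increases with it. *)
Lemma card_components_le : (#|components G S| <= r_S (incidence R G) S)%N.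
Proof.
pose M := \matrix_(a < #|components G S|, i < n) (u (enum_val a)) i 0.
have MMt : M *m M^T = 1%:M.
  apply/matrixP => a b; rewrite !mxE.
  have := component_orthonormal (enum_valP a) (enum_valP b).
  rewrite (inj_eq enum_val_inj) => <-.
  by apply: eq_bigr => i _; rewrite !mxE.
have /eqP <- : row_free M by apply/row_freeP; exists M^T.
apply/mxrankS/sub_kermxP/matrixP => a k; rewrite !mxE.
transitivity ((incidence R G *m u (enum_val a)) (enum_val k) 0).
  rewrite mxE; apply: eq_bigr => i _; rewrite !mxE mulrC //.
rewrite incidence_mulE component_vector_constant ?subrr //.
  exact: enum_valP.
by have := enum_valP k; rewrite finset.inE.
Qed.

Lemma components_gt0 : (0 < n)%N -> (0 < #|components G S|)%N.
Proof.
move=> n0; rewrite card_gt0; apply/set0Pn.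
exists (finset.pblock (components G S) (Ordinal n0)); rewrite finset.pblock_mem //.
by have /and3P[/eqP -> _ _] := components_partition; rewrite finset.inE.
Qed.

End Components.

Section Decomposition.
Context (R : realType) (n m : nat) (G : digraph n m) (S : {set 'I_m}).

Local Notation D := (incidence R G).
Local Notation u := (@component_vector R n).
Local Notation comps := (components G S).

(** Removing from [g] the vectors [v j], weighted by the differences of [g] along
    the edges [j] outside [S], leaves a vector that is constant on components and
    so has residual 0; the residuals of the [v j] are the vectors [z j]. *)
Lemma component_edge_decomposition : independent_edges R G S ->
  exists z : 'I_m -> 'cV[R]_n,
    (forall j, j \notin S -> dot (z j) (z j) <= (n_max G S)%:R / 4) /\
    (forall g : 'cV[R]_n,
      g = \sum_(C in comps) dot (u C) g *: u C
          + \sum_(j | j \notin S) (D *m g) j 0 *: z j).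
Proof.
move=> ind.
have orth := @component_orthonormal R n m G S.
have exv j : exists v : 'cV[R]_n, j \notin S ->
    dot v v <= (n_max G S)%:R / 4 /\
    forall k, k \notin S -> (D *m v) k 0 = (k == j)%:R.
  have [jS|jS] := boolP (j \in S); first by exists 0.
  have [p pS] := ind j jS; exists (side_vector G S j p) => _; split.
    exact: side_vector_norm.
  exact: side_vector_edge.
have [v vP] := choice exv.
exists (fun j => residual comps u (v j)); split => [j jS|g].
  exact: le_trans (dot_residual_le orth (v j)) (vP j jS).1.
set s := \sum_(j | j \notin S) (D *m g) j 0 *: v j.
have : residual comps u (g - s) = 0.
  apply/eqP; rewrite subr_eq0; apply/eqP.
  apply: component_expansion => k kS; apply/eqP.
  rewrite -subr_eq0 -incidence_mulE mulmxBr mxE [X in _ + X]mxE subr_eq0.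
  rewrite /s mulmx_sumr summxE (bigD1 k) //= big1 ?addr0; last first.
    move=> j /andP[jS jk].
    by rewrite -scalemxAr mxE (vP j jS).2 // eq_sym (negbTE jk) mulr0.
  by rewrite -scalemxAr [in X in _ == X]mxE (vP k kS).2 // eqxx mulr1.
rewrite residualB /s residual_sum => /eqP; rewrite subr_eq0 => /eqP <-.
by rewrite /residual addrC subrK.
Qed.

End Decomposition.

(** * The total variation objective *)

Lemma sqnorm_nE (R : realType) n (g : 'cV[R]_n) : sqnorm_n g = dot g g / n%:R.
Proof. by congr (_ / _); apply: eq_bigr => i _; rewrite expr2. Qed.

Section Argmin.
Context (R : realType) (n m : nat) (D : 'M[R]_(m, n)) (lambda : R).
Hypothesis lambda0 : 0 < lambda.
Implicit Types y f g : 'cV[R]_n.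

Lemma norm1_convex (a b : 'cV[R]_m) (tau : R) : 0 <= tau <= 1 ->
  norm1 (a + tau *: (b - a)) <= (1 - tau) * norm1 a + tau * norm1 b.
Proof.
move=> /andP[t0 t1]; rewrite /norm1 !mulr_sumr -big_split; apply: ler_sum => j _.
rewrite !mxE.
have -> : a j 0 + tau * (b j 0 - a j 0) = (1 - tau) * a j 0 + tau * b j 0 by ring.
rewrite (le_trans (ler_normD _ _)) // !normrM (ger0_norm t0) ger0_norm //.
by rewrite subr_ge0.
Qed.

(** Moving from [fh] towards [g] by a fraction [tau] changes the objective by at
    most [tau] times the difference of the objectives minus
    [tau (1 - tau) sqnorm_n (fh - g)]; divide by [tau] and let it tend to 0. *)
Lemma tv_argmin_strong y fh g : tv_argmin D lambda y fh ->
  tv_objective D lambda y fh + sqnorm_n (fh - g) <= tv_objective D lambda y g.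
Proof.
move=> opt; set N := sqnorm_n _.
have N0 : 0 <= N by rewrite /N sqnorm_nE divr_ge0 ?dot_ge0.
apply/ler_addgt0Pr => e e0.
(* [tau * N <= e], and [N + 1] keeps the denominator positive. *)
pose tau := Num.min 1 (e / (N + 1)).
have N1 : 0 < N + 1 by rewrite ltr_wpDl.
have t0 : 0 < tau by rewrite lt_min ltr01 divr_gt0.
have t1 : tau <= 1 by rewrite ge_min lexx.
have tN : tau * N <= e.
  apply: (@le_trans _ _ (e / (N + 1) * (N + 1))); last by rewrite divfK ?gt_eqF.
  by apply: ler_pM => //; [exact: ltW|rewrite ge_min lexx orbT|rewrite lerDl].
have := opt (fh + tau *: (g - fh)).
rewrite /tv_objective mulmxDr -scalemxAr mulmxBr.
have := @norm1_convex (D *m fh) (D *m g) tau; rewrite (ltW t0) t1 => /(_ isT).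
set n1 := norm1 (_ + _); set nh := norm1 _; set ng := norm1 _ => cvx.
have -> : sqnorm_n (y - (fh + tau *: (g - fh))) =
    (1 - tau) * sqnorm_n (y - fh) + tau * sqnorm_n (y - g) - tau * (1 - tau) * N.
  rewrite /N !sqnorm_nE; set nV := n%:R^-1.
  rewrite !(dotDl, dotDr, dotBl, dotBr, dotNl, dotNr, dotZl, dotZr).
  rewrite (dotC g fh) (dotC g y) (dotC fh y); ring.
set sh := sqnorm_n (y - fh); set sg := sqnorm_n (y - g) => H.
have : tau * (sh + 2 * lambda * nh + N) <= tau * (sg + 2 * lambda * ng + e).
  have : 2 * lambda * n1 <= 2 * lambda * ((1 - tau) * nh + tau * ng).
    by rewrite ler_wpM2l // mulr_ge0 // ltW.
  have : tau * (tau * N) <= tau * e by rewrite ler_wpM2l // ltW.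
  lra.
by rewrite ler_pM2l.
Qed.

(** The margin of [tv_argmin_strong] pays for the term [dot g g] that Young's
    inequality produces from the part of [g] in the span of the [u k]; in the edge
    part, the differences of [fh] cancel against its penalty and those of [f] are
    added to the penalty of [f], doubling it. *)
Lemma tv_oracle_inequality (I : finType) (A : {set I}) (u : I -> 'cV[R]_n)
    (S : {set 'I_m}) (z : 'I_m -> 'cV[R]_n) f0 e fh f (q : R) :
  (0 < n)%N ->
  {in A &, forall k l, dot (u k) (u l) = (k == l)%:R} ->
  (forall g, g = \sum_(k in A) dot (u k) g *: u k
          + \sum_(j | j \notin S) (D *m g) j 0 *: z j) ->
  tv_argmin D lambda (f0 + e) fh ->
  \sum_(k in A) dot (u k) e ^+ 2 <= q ->
  (forall j, j \notin S -> `|dot (z j) e| <= n%:R * lambda) ->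
  sqnorm_n (fh - f0)
    <= sqnorm_n (f - f0) + q / n%:R + 4 * lambda * norm1 (D *m f).
Proof.
move=> n0 orth dec opt eq ez.
have n0' : 0 < n%:R :> R by rewrite ltr0n.
set g := fh - f.
have nois : 2 * dot e g <= q + dot g g
    + 2 * (n%:R * lambda * (norm1 (D *m fh) + norm1 (D *m f))).
  rewrite {1}(dec g) dotDr mulrDr; apply: lerD.
    apply: (@le_trans _ _ (\sum_(k in A) dot (u k) e ^+ 2
      + \sum_(k in A) dot (u k) g ^+ 2)).
      rewrite dot_sumr mulr_sumr -big_split; apply: ler_sum => k _ /=.
      rewrite dotZr (dotC e) -subr_ge0.
      by rewrite (_ : _ - _ = (dot (u k) e - dot (u k) g) ^+ 2) ?sqr_ge0 //; ring.
    by apply: lerD => //; exact: bessel.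
  rewrite ler_pM2l // dot_sumr mulrDr /norm1 !mulr_sumr -big_split /=.
  rewrite big_mkcond; apply: ler_sum => j _; rewrite -mulrDr.
  have nl0 : 0 <= n%:R * lambda by rewrite mulr_ge0 // ltW.
  case: ifPn => jS; last by rewrite mulr_ge0 // addr_ge0.
  rewrite dotZr (le_trans (ler_norm _)) // normrM mulrC (dotC e).
  apply: ler_pM => //; first exact: ez.
  by rewrite /g mulmxBr mxE [X in _ + X]mxE ler_normB.
have := tv_argmin_strong f opt; rewrite /tv_objective !sqnorm_nE -/g.
rewrite -(ler_pM2l n0') => H.
rewrite -(ler_pM2l n0').
have E a : n%:R * (a / n%:R) = a :> R by rewrite mulrCA divff ?mulr1 ?gt_eqF.
move: H; rewrite !mulrDr !E.
have -> : f0 + e - fh = e - (fh - f0) by rewrite opprB addrA [e + f0]addrC.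
have -> : f0 + e - f = e - (f - f0) by rewrite opprB addrA [e + f0]addrC.
move: nois; have -> : dot e g = dot e (fh - f0) - dot e (f - f0).
  by rewrite -dotBr opprB addrA subrK.
have sq (a : 'cV[R]_n) : dot (e - a) (e - a) = dot e e - 2 * dot e a + dot a a.
  by rewrite !(dotBr, dotBl) (dotC a e); ring.
rewrite !sq; lra.
Qed.

End Argmin.

(** * Measurability of the estimator *)

Lemma measurable_superlevel (R : realType) d (T : measurableType d)
    (X : T -> R) (a : R) :
  measurable_fun [set: T] X -> measurable [set w | a <= X w].
Proof.
move=> mX; have -> : [set w | a <= X w] = [set: T] `&` X @^-1` `[a, +oo[.
  by rewrite setTI; apply/seteqP; split => w; rewrite /= in_itv /= andbT.
exact: mX.
Qed.

Lemma countable_bigcap_measurable d (T : measurableType d) (U : countType)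
    (F : U -> set T) : (forall i, measurable (F i)) -> measurable (\bigcap_i F i).
Proof.
move=> mF; rewrite -[X in measurable X]setCK setC_bigcap; apply: measurableC.
by apply: countable_bigcupT_measurable => // i; exact: measurableC.
Qed.

Lemma measurable_fun_sublevels (R : realType) d (T : measurableType d)
    (X : T -> R) :
  (forall a, measurable [set w | X w <= a]) -> measurable_fun [set: T] X.
Proof.
move=> mX mT; apply: (measurability _ (RGenOInfty.measurableE R)) => //.
move=> _ [_ [a ->] <-]; rewrite setTI.
rewrite (_ : _ @^-1` _ = ~` [set w | X w <= a]); first exact: measurableC.
apply/seteqP; split => w /=; rewrite in_itv /= andbT ltNge; first by move/negP.
by move=> H; apply/negP.
Qed.

Lemma tv_objective_continuous (R : realType) m n (D : 'M[R]_(m, n)) (lambda : R)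
    (y : 'cV[R]_n) : continuous (tv_objective D lambda y).
Proof.
move=> f.
have cvc i : (fun g : 'cV[R]_n => g i 0) @ f --> f i 0 by exact: coord_continuous.
have csum (I : finType) (h : I -> 'cV[R]_n -> R) :
    (forall i, h i g @[g --> f] --> h i f) ->
    (\sum_i h i g) @[g --> f] --> \sum_i h i f.
  move=> hh; apply: (@cvg_big R I +%R 0 xpredT (@add_continuous R) 'cV[R]_n
    (nbhs f) _ h (h^~ f) (nbhs_filter f)) => i _; exact: hh.
have csq : (sqnorm_n (y - g)) @[g --> f] --> sqnorm_n (y - f).
  have c1 i : ((y - g) i 0 ^+ 2) @[g --> f] --> (y - f) i 0 ^+ 2.
    have -> : (fun g : 'cV[R]_n => (y - g) i 0 ^+ 2) =
        (fun g => (y i 0 - g i 0) * (y i 0 - g i 0)).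
      by apply/funext => g; rewrite !mxE expr2.
    have c0 : (fun g : 'cV[R]_n => y i 0 - g i 0) @ f --> y i 0 - f i 0.
      exact: (cvgB (cvg_cst (y i 0)) (cvc i)).
    by rewrite !mxE expr2; exact: (cvgM c0 c0).
  exact: (cvgMr_tmp (csum _ (fun i g => (y - g) i 0 ^+ 2) c1)).
have cn1 : (norm1 (D *m g)) @[g --> f] --> norm1 (D *m f).
  have c1 j : ((D *m g) j 0) @[g --> f] --> (D *m f) j 0.
    have -> : (fun g : 'cV[R]_n => (D *m g) j 0) =
        (fun g => \sum_i D j i * g i 0).
      by apply/funext => g; rewrite mxE.
    rewrite mxE; apply: (csum _ (fun i g => D j i * g i 0)) => i.
    exact: (cvgMl_tmp (cvc i)).
  exact: (csum _ (fun j g => `|(D *m g) j 0|) (fun j => cvg_norm (c1 j))).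
exact: (cvgD csq (cvgMl_tmp cn1)).
Qed.

(** The approximating rational vector is taken from above in each coordinate,
    within the radius given by continuity. *)
Lemma rational_approximation (R : realType) n (F : 'cV[R]_n -> R) (f : 'cV[R]_n)
    (delta : R) : {for f, continuous F} -> 0 < delta ->
  exists q : 'cV[rat]_n, F (map_mx ratr q) <= F f + delta /\
    forall i, ratr (q i 0) <= f i 0 + delta.
Proof.
move=> cF d0.
have /nbhs_ballP[r /= r0 rF] : \forall g \near f, F g <= F f + delta.
  have H := cvgr_dist_le F (F f) cF delta d0.
  near=> g; have : `|F f - F g| <= delta by near: g; exact: H.
  by rewrite ler_norml lerBrDl => /andP[+ _]; rewrite lerBlDr addrC.
pose s := Num.min r delta.
have s0 : 0 < s by rewrite lt_min r0 d0.
have ex i : exists q : rat, f i 0 < ratr q < f i 0 + s.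
  have [q] := @rat_in_itvoo _ (f i 0) (f i 0 + s) ltac:(by rewrite ltrDl).
  by rewrite in_itv /= => ?; exists q.
have [q qP] := choice ex.
exists (\col_i q i); split=> [|i].
  apply: rF; split=> // i j; rewrite (ord1 j) !mxE /ball /=.
  have /andP[q1 q2] := qP i.
  rewrite distrC ger0_norm ?subr_ge0 ?(ltW q1) // ltrBlDl.
  by rewrite (lt_le_trans q2) // lerD2l ge_min lexx.
have /andP[_ q2] := qP i; rewrite mxE (le_trans (ltW q2)) // lerD2l.
by rewrite ge_min lexx orbT.
Unshelve. all: by end_near.
Qed.

(** The i-th coordinate of the minimizer is at most [a] if and only if for each
    [k] some rational vector [q] has objective within [del k ^+ 2] of that of every
    rational vector and i-th coordinate at most [a + del k]: by
    [tv_argmin_strong] such a [q] is within [del k] of the minimizer in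
    the normalized norm.  These are countably many conditions on [y w]. *)
Lemma tv_argmin_measurable (R : realType) d (T : measurableType d) m n
    (D : 'M[R]_(m, n)) (lambda : R) (y fhat : T -> 'cV[R]_n) :
  (0 < n)%N -> 0 < lambda ->
  (forall i, measurable_fun [set: T] (fun w => y w i 0)) ->
  (forall w, tv_argmin D lambda (y w) (fhat w)) ->
  forall i, measurable_fun [set: T] (fun w => fhat w i 0).
Proof.
move=> n0 l0 my opt i; apply: measurable_fun_sublevels => a.
have n0' : 0 < n%:R :> R by rewrite ltr0n.
pose Q (q : 'cV[rat]_n) : 'cV[R]_n := map_mx ratr q.
pose del (k : nat) : R := k.+1%:R^-1.
have del0 k : 0 < del k by rewrite invr_gt0.
have del1 k : del k <= 1 by rewrite invf_le1 // ler1n.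
pose B k q := \bigcap_(q' : 'cV[rat]_n)
  [set w | tv_objective D lambda (y w) (Q q)
           <= tv_objective D lambda (y w) (Q q') + del k ^+ 2].
have mobj f : measurable_fun [set: T] (fun w => tv_objective D lambda (y w) f).
  apply: measurable_funD => //; apply: measurable_funM => //.
  apply: measurable_sum => j; apply: measurable_funX.
  under eq_fun do rewrite !mxE.
  exact: measurable_funB.
have mB k q : measurable (B k q).
  apply: countable_bigcap_measurable => q'.
  rewrite [X in measurable X](_ : _ = [set w | - del k ^+ 2 <=
    tv_objective D lambda (y w) (Q q') - tv_objective D lambda (y w) (Q q)]).
    by apply: measurable_superlevel; apply: measurable_funB.
  by apply/seteqP; split => w /=; lra.
rewrite [X in measurable X](_ : _ = \bigcap_k \bigcup_(q : 'cV[rat]_n)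
  (B k q `&` [set w | Q q i 0 <= a + del k])); last first.
  apply/seteqP; split => w /=.
    move=> fa k _; have d2 : 0 < del k ^+ 2 by rewrite exprn_gt0.
    have [q [q1 q2]] := rational_approximation
      (@tv_objective_continuous R m n D lambda (y w) (fhat w)) d2.
    exists q => //; split=> [q' _ /=|].
      by rewrite (le_trans q1) // lerD2r; exact: opt.
    rewrite /Q mxE (le_trans (q2 i)) // lerD // expr2.
    by rewrite ler_piMl // ltW.
  move=> H.
  suff lim k : fhat w i 0 <= a + (n%:R + 1) * del k.
    rewrite leNgt; apply/negP => alt.
    have n1 : 0 < n%:R + 1 :> R by rewrite ltr_wpDl.
    have e0 : 0 < (fhat w i 0 - a) / (n%:R + 1) by rewrite divr_gt0 // subr_gt0.
    have [k _ /(_ k (leqnn k))] := near_infty_natSinv_lt (PosNum e0).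
    rewrite /= ltr_pdivlMr // => small.
    have := lim k; rewrite leNgt => /negP; apply.
    by rewrite -ltrBrDl mulrC.
  have [q _ [Bq /= qa]] := H k I.
  have near : tv_objective D lambda (y w) (Q q)
      <= tv_objective D lambda (y w) (fhat w) + del k ^+ 2.
    apply/ler_addgt0Pr => e e0.
    have [q' [q1 _]] := rational_approximation
      (@tv_objective_continuous R m n D lambda (y w) (fhat w)) e0.
    have := Bq q' I; rewrite /= => /le_trans; apply; rewrite /Q in q1 *; lra.
  have := tv_argmin_strong l0 (Q q) (opt w); move/le_trans => /(_ _ near).
  rewrite lerD2l sqnorm_nE ler_pdivrMr // => dist.
  have : (fhat w i 0 - Q q i 0) ^+ 2 <= (n%:R * del k) ^+ 2.
    apply: (@le_trans _ _ (dot (fhat w - Q q) (fhat w - Q q))).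
      rewrite /dot (bigD1 i) //= -expr2 !mxE lerDl.
      by apply: sumr_ge0 => j _; rewrite -expr2 sqr_ge0.
    rewrite (le_trans dist) // exprMn mulrC ler_wpM2r ?sqr_ge0 //.
    by rewrite expr2 ler_peMr ?ler1n // ltW.
  have b0 : 0 <= n%:R * del k by rewrite mulr_ge0 // ltW.
  move=> sq; have : fhat w i 0 - Q q i 0 <= n%:R * del k.
    rewrite leNgt; apply/negP => lt; move: sq; apply/negP; rewrite -ltNge.
    by rewrite ltr_sqr ?nnegrE // (le_trans b0) // ltW.
  lra.
apply: bigcapT_measurable => k.
apply: countable_bigcupT_measurable => // q.
apply: measurableI => //.
have [qa|qa] := boolP (Q q i 0 <= a + del k).
  by rewrite (_ : [set _ | _] = setT) //; apply/seteqP; split.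
rewrite (_ : [set _ | _] = set0) //; apply/seteqP; split => //.
Qed.

(** * Exponential moments of Gaussian vectors *)

Section WeightedLaw.
Import HBNNSimple.

(** If weighting [P] by [W] turns the law of [X] into [c] times [nu], then
    integrals against the weighted measure follow from monotone convergence along
    simple functions.  With a density as weight this is a change of measure, and
    with the remaining factors of a product as weight it replaces one factor of an
    expectation. *)
Lemma integral_weighted_law (R : realType) d (T : measurableType d)
    d' (T' : measurableType d')
    (P : {measure set T -> \bar R}) (nu : {measure set T' -> \bar R})
    (X : T -> T') (W : T -> R) (c : R) :
  measurable_fun [set: T] X -> measurable_fun [set: T] W ->
  (forall w, 0 <= W w) -> 0 <= c ->
  (forall A, measurable A ->
    \int[P]_w ((W w)%:E * (\1_A (X w))%:E) = c%:E * nu A)%E ->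
  forall phi : T' -> R, measurable_fun [set: T'] phi -> (forall y, 0 <= phi y) ->
  (\int[P]_w ((W w)%:E * (phi (X w))%:E) = c%:E * \int[nu]_y (phi y)%:E)%E.
Proof.
move=> mX mW W0 c0 WA phi mphi phi0.
have mphi' : measurable_fun [set: T'] (EFin \o phi) by exact/measurable_EFinP.
pose h := nnsfun_approx measurableT mphi'.
have hphi y : (EFin \o h^~ y) @ \oo --> (phi y)%:E.
  by apply: cvg_nnsfun_approx => // z _; rewrite lee_fin.
have mWh (g : T' -> R) : measurable_fun [set: T'] g ->
    measurable_fun [set: T] (fun w => (W w)%:E * (g (X w))%:E)%E.
  move=> mg; apply: emeasurable_funM; apply/measurable_EFinP => //.
  exact: measurableT_comp.
have step n : (\int[P]_w ((W w)%:E * (h n (X w))%:E)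
    = c%:E * \int[nu]_y (h n y)%:E)%E.
  transitivity (\int[P]_w (\sum_(y \in range (h n))
     (y%:E * ((W w)%:E * (\1_(h n @^-1` [set y]) (X w))%:E))))%E.
    apply: eq_integral => w _.
    rewrite [in LHS]fimfunE -fsumEFin // ge0_mule_fsumr; last first.
      by move=> y; exact: nnfun_muleindic_ge0.
    by apply: eq_fsbigr => y _; rewrite EFinM muleCA.
  rewrite ge0_integral_fsum //; last 2 first.
  - by move=> y; apply: emeasurable_funM => //; apply: mWh.
  - move=> y w _; case: (leP 0 y) => y0.
      by rewrite !mule_ge0 // lee_fin.
    by rewrite preimage_nnfun0 // indic0 mule0 mule0.
  - rewrite integralT_nnsfun sintegralE ge0_mule_fsumr; last first.
      by move=> y; exact: nnsfun_mulemu_ge0.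
    apply: eq_fsbigr => r; rewrite inE => -[z _ <-] {r}.
    rewrite ge0_integralZl //.
    + by rewrite WA // muleCA.
    + exact: mWh.
    + by move=> w _; rewrite mule_ge0 // lee_fin.
    + by rewrite lee_fin.
have ndh y : {homo (fun n => (h n y)%:E) : a b / (a <= b)%N >-> (a <= b)%E}.
  by move=> a b ab; rewrite lee_fin; exact/lefP/nd_nnsfun_approx.
have limP : (\int[P]_w ((W w)%:E * (h n (X w))%:E) @[n --> \oo] -->
    \int[P]_w ((W w)%:E * (phi (X w))%:E))%E.
  have -> : (\int[P]_w ((W w)%:E * (phi (X w))%:E) =
      \int[P]_w limn (fun n => (W w)%:E * (h n (X w))%:E))%E.
    apply: eq_integral => w _; apply/esym/cvg_lim => //.
    exact: (cvgeZl _ (hphi (X w))).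
  apply: cvg_monotone_convergence => //.
  - by move=> n; exact: mWh.
  - by move=> n w _; rewrite mule_ge0 // lee_fin.
  - by move=> w _ a b ab; apply: lee_wpmul2l; rewrite ?lee_fin // -lee_fin ndh.
have {}limP : ((fun n => c%:E * \int[nu]_y (h n y)%:E) @ \oo -->
    \int[P]_w ((W w)%:E * (phi (X w))%:E))%E.
  by move: limP; rewrite (funext step).
apply/esym/(cvg_unique _ _ limP) => //; apply: cvgeZl => //.
have -> : (\int[nu]_y (phi y)%:E = \int[nu]_y limn (fun n => (h n y)%:E))%E.
  by apply: eq_integral => y _; apply/esym/cvg_lim => //; exact: hphi.
apply: cvg_monotone_convergence => //.
- by move=> n; apply/measurable_EFinP.
- by move=> n y _; rewrite lee_fin.
Qed.

End WeightedLaw.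

Lemma measurable_fun_prod_comp (R : realType) d (T : measurableType d)
    (n : nat) (X : 'I_n -> T -> R) (Q : pred 'I_n) (psi : 'I_n -> R -> R) :
  (forall i, measurable_fun [set: T] (X i)) ->
  (forall i, measurable_fun [set: R] (psi i)) ->
  measurable_fun [set: T] (fun w => \prod_(i | Q i) psi i (X i w)).
Proof.
move=> mX mpsi.
rewrite [X in measurable_fun _ X](_ : _ =
    (fun w => \prod_(i <- [seq i <- index_enum 'I_n | Q i]) psi i (X i w)));
  last first.
  by apply/funext => w; rewrite big_filter.
elim: [seq i <- _ | _] => [|i s IH].
  by under eq_fun do rewrite big_nil; exact: measurable_cst.
under eq_fun do rewrite big_cons; apply: measurable_funM => //.
exact: measurableT_comp.
Qed.

(** Independence on boxes is the case where each [psi i] is an indicator.  The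
    induction runs over the set [J] of the coordinates whose factor is arbitrary:
    a coordinate joins [J] by [integral_weighted_law], the product of the other
    factors being the weight. *)
Lemma expectation_prod (R : realType) d (T : measurableType d)
    (P : probability T R) (n : nat) (X : 'I_n -> {RV P >-> R})
    (nu : probability (measurableTypeR R) R) :
  (forall A : 'I_n -> set R, (forall i, measurable (A i)) ->
     P [set w | forall i, A i (X i w)] = (\prod_(i < n) nu (A i))%E) ->
  forall psi : 'I_n -> R -> R,
  (forall i, measurable_fun [set: R] (psi i)) ->
  (forall i y, 0 <= psi i y) ->
  (forall i, \int[nu]_y (psi i y)%:E \is a fin_num)%E ->
  (\int[P]_w (\prod_(i < n) psi i (X i w))%:E
   = \prod_(i < n) \int[nu]_y (psi i y)%:E)%E.
Proof.
move=> Pprod psi mpsi psi0 psifin.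
suff main (J : {set 'I_n}) (phi : 'I_n -> R -> R) :
    (forall i, measurable_fun [set: R] (phi i)) ->
    (forall i y, 0 <= phi i y) ->
    (forall i, \int[nu]_y (phi i y)%:E \is a fin_num)%E ->
    (forall i, i \notin J -> exists2 A, measurable A & phi i = \1_A) ->
  (\int[P]_w (\prod_(i < n) phi i (X i w))%:E
   = \prod_(i < n) \int[nu]_y (phi i y)%:E)%E.
  by apply: (main finset.setT) => // i; rewrite finset.in_setT.
move: {2}#|J| (leqnn #|J|) => k.
elim: k J phi {mpsi psi0 psifin psi} => [|k IH] J psi Jk mpsi psi0 psifin psiind.
  have J0 : J = finset.set0 by apply/eqP; rewrite -cards_eq0 -leqn0.
  have {}psiind i : exists A, measurable A /\ psi i = \1_A.
    by have [|A mA ->] := psiind i; [rewrite J0 finset.inE|exists A].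
  have [A AP] := choice psiind.
  under [RHS]eq_bigr => i _.
    rewrite (AP i).2 integral_indic ?setIT; [|by []|exact: (AP i).1].
    over.
  rewrite -Pprod; last by move=> i; exact: (AP i).1.
  have -> : [set w | forall i, A i (X i w)] =
      \bigcap_(i in [set: 'I_n]) (X i @^-1` A i).
    by apply/seteqP; split => w /= Bw i => [_|]; exact: Bw.
  have mB : measurable (\bigcap_(i in [set: 'I_n]) (X i @^-1` A i)).
    apply: fin_bigcap_measurable => // i _.
    rewrite -[X in measurable X]setTI; apply: measurable_funP => //.
    exact: (AP i).1.
  rewrite -[X in P X]setIT -integral_indic //; apply: eq_integral => w _.
  congr EFin; under eq_bigr => i _ do rewrite (AP i).2.
  rewrite indicE; case: (boolP (w \in _)); rewrite ?inE /= => wB.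
    rewrite big1 // => i _; rewrite indicE mem_set //; exact: wB.
  have [i iB] : exists i, ~ A i (X i w).
    apply/existsNP => wA; move/negP: wB; apply; rewrite inE => i _; exact: wA.
  by rewrite (bigD1 i) //= indicE memNset // mul0r.
have [J0|[j jJ]] := set_0Vmem J.
  by apply: (IH J) => //; rewrite J0 cards0.
have jk : (#|(J :\ j)%SET| <= k)%N.
  by rewrite -ltnS (leq_trans _ Jk) // (cardsD1 j J) jJ.
pose c := (\prod_(i < n | i != j) \int[nu]_y (psi i y)%:E)%E.
have c0 : (0 <= c)%E.
  by apply: prode_ge0 => i _; apply: integral_ge0 => y _; rewrite lee_fin.
have cfin : c \is a fin_num.
  by rewrite /c prode_fin_num.
rewrite [RHS](bigD1 j) //= -/c muleC -(fineK cfin).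
under eq_integral do rewrite (bigD1 j) //= mulrC EFinM.
apply: (@integral_weighted_law _ _ _ _ _ P nu (X j) _ _ _ _ _ _ _ _
  (mpsi j)) => //.
- exact: (measurable_funPT (X j)).
- apply: measurable_fun_prod_comp => //.
- by move=> w; apply: prodr_ge0.
- by rewrite fine_ge0.
move=> A mA; rewrite fineK //.
pose psi' i := if i == j then \1_A else psi i.
have psi'j i : i != j -> psi' i = psi i by rewrite /psi' => /negbTE ->.
have -> : (c * nu A = \prod_(i < n) \int[nu]_y (psi' i y)%:E)%E.
  rewrite [RHS](bigD1 j) //= {1}/psi' eqxx integral_indic // setIT muleC.
  by congr (_ * _)%E; apply: eq_bigr => i ij; rewrite psi'j.
rewrite -(IH (J :\ j)%SET psi' jk).
- apply: eq_integral => w _; rewrite [in RHS](bigD1 j) //= mulrC EFinM.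
  congr (_%:E * _)%E; last by rewrite /psi' eqxx.
  by apply: eq_bigr => i ij; rewrite psi'j.
- move=> i; rewrite /psi'; case: eqP => // _.
- move=> i y; rewrite /psi'; case: eqP => // _.
- move=> i; rewrite /psi'; case: eqP => // _.
  by rewrite integral_indic // setIT fin_num_measure.
move=> i; rewrite finset.inE negb_and negbK finset.inE /psi'.
case: eqP => [_ _|_ /=].
  by exists A.
exact: psiind.
Qed.

Lemma integral_normal_prob_pdf (R : realType) (m s : R) (phi : R -> R) :
  measurable_fun [set: R] phi -> (forall y, 0 <= phi y) ->
  (\int[normal_prob m s]_y (phi y)%:E
   = \int[lebesgue_measure]_y ((normal_pdf m s y)%:E * (phi y)%:E))%E.
Proof.
move=> mphi phi0.
rewrite (@integral_weighted_law R _ _ _ _ lebesgue_measure (normal_prob m s) id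
  (normal_pdf m s) 1) ?mul1e //.
- exact: measurable_normal_pdf.
- exact: normal_pdf_ge0.
move=> A mA; rewrite mul1e.
transitivity (\int[lebesgue_measure]_(y in A) (normal_pdf m s y)%:E)%E => //.
rewrite [RHS]integral_mkcond.
apply: eq_integral => y _; rewrite epatch_indic //.
Qed.

(** Completing the square: the integrand is a constant times the density of a
    normal law of variance [sigma ^+ 2 / (1 - 2 * s)]. *)
Lemma normal_quadratic_mgf (R : realType) (sigma c s : R) :
  0 < sigma -> s < 1 / 2 ->
  (\int[normal_prob 0 sigma]_y (expR (c * y + s * (y / sigma) ^+ 2))%:E
   = ((Num.sqrt (1 - 2 * s))^-1
      * expR ((c * sigma) ^+ 2 / (2 * (1 - 2 * s))))%:E)%E.
Proof.
move=> sigma0 s2.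
have k0 : 0 < 1 - 2 * s by lra.
set k := 1 - 2 * s in k0 *.
pose sk := Num.sqrt k; have sk0 : 0 < sk by rewrite sqrtr_gt0.
have skE : sk ^+ 2 = k by rewrite sqr_sqrtr // ltW.
rewrite integral_normal_prob_pdf; last 2 first.
- apply: measurableT_comp => //; apply: measurable_funD; first exact: mulrl_measurable.
  apply: measurable_funM => //; apply: measurable_funX.
  exact: mulrr_measurable.
- by move=> y; exact: expR_ge0.
pose m' := c * sigma ^+ 2 / k; pose s' := sigma / sk.
have s'0 : 0 < s' by rewrite divr_gt0.
under eq_integral => y _.
  rewrite -EFinM (_ : _ * _ = sk^-1 * expR ((c * sigma) ^+ 2 / (2 * k))
    * normal_pdf m' s' y).
    rewrite EFinM; over.
  rewrite !normal_pdfE ?gt_eqF //.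
  have -> : normal_peak sigma = sk^-1 * normal_peak s'.
    rewrite /normal_peak -invfM -mulrnAr sqrtrM ?sqr_ge0 // sqrtr_sqr.
    rewrite -mulrnAr sqrtrM ?sqr_ge0 // sqrtr_sqr !gtr0_norm // /s'.
    by rewrite mulrA mulrC [sk * _]mulrC divfK ?gt_eqF // mulrC.
  rewrite -!mulrA; congr (_ * _); rewrite [RHS]mulrCA; congr (_ * _).
  rewrite /normal_fun -!expRD; congr expR.
  rewrite /m' /s' !expr_div_n skE.
  have sg : sigma != 0 by rewrite gt_eqF.
  have kn : 1 - 2 * s != 0 by rewrite gt_eqF.
  by rewrite /k; field; rewrite sg kn.
rewrite ge0_integralZl ?integral_normal_pdf ?mule1 //.
- by apply/measurable_EFinP; exact: measurable_normal_pdf.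
- by move=> y _; rewrite lee_fin normal_pdf_ge0.
by rewrite lee_fin mulr_ge0 ?invr_ge0 ?expR_ge0 // ltW.
Qed.

Lemma measurable_dot (R : realType) d (T : measurableType d) (n : nat)
    (Y : T -> 'cV[R]_n) (b : 'cV[R]_n) :
  (forall i, measurable_fun [set: T] (fun w => Y w i 0)) ->
  measurable_fun [set: T] (fun w => dot b (Y w)).
Proof.
move=> mY; apply: measurable_sum => i; apply: measurable_funM => //.
Qed.

(** Being a centred Gaussian vector with covariance [sigma ^+ 2] times the
    identity, expressed by the exponential moments of all linear forms. *)
Definition gaussian_mgf (R : realType) d (T : measurableType d)
    (P : probability T R) (n : nat) (sigma : R) (Y : T -> 'cV[R]_n) :=
  (forall i, measurable_fun [set: T] (fun w => Y w i 0)) /\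
  forall b, (\int[P]_w (expR (dot b (Y w)))%:E =
             (expR (sigma ^+ 2 / 2 * dot b b))%:E)%E.

Lemma white_noise_mgf (R : realType) d (T : measurableType d)
    (P : probability T R) (n : nat) (eps : 'I_n -> {RV P >-> R}) (sigma : R) :
  0 < sigma -> white_noise eps sigma ->
  gaussian_mgf P sigma (fun w => \col_i eps i w).
Proof.
move=> sigma0 wn; split=> [i|b].
  by under eq_fun do rewrite mxE; exact: measurable_funP.
have mgf1 c : (\int[normal_prob 0 sigma]_y (expR (c * y))%:E =
    (expR ((c * sigma) ^+ 2 / 2))%:E)%E.
  have := @normal_quadratic_mgf R sigma c 0 sigma0.
  rewrite !mulr0 subr0 sqrtr1 invr1 !mul1r mulr1 => <-; last by lra.
  by under [RHS]eq_integral do rewrite mul0r addr0.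
transitivity (\int[P]_w (\prod_(i < n) expR (b i 0 * eps i w))%:E)%E.
  apply: eq_integral => w _; rewrite /dot expR_sum; congr EFin.
  by apply: eq_bigr => i _; rewrite mxE.
rewrite (@expectation_prod R d T P n eps
  (normal_prob 0 sigma : probability (measurableTypeR R) R) wn
  (fun i y => expR (b i 0 * y))).
- under eq_bigr do rewrite mgf1.
  rewrite prodEFin -expR_sum mulr_sumr; congr (expR _)%:E.
  by apply: eq_bigr => i _; ring.
- by move=> i; apply: measurableT_comp => //; exact: mulrl_measurable.
- by move=> i y; exact: expR_ge0.
by move=> i; rewrite mgf1.
Qed.

(** This turns the exponential of a square into an average of exponentials of
    linear forms, at the price of one auxiliary Gaussian variable. *)
Lemma gaussian_linearize (R : realType) (s a : R) : 0 <= s ->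
  (\int[normal_prob 0 1]_y (expR (Num.sqrt (2 * s) * a * y))%:E
   = (expR (s * a ^+ 2))%:E)%E.
Proof.
move=> s0; have := @normal_quadratic_mgf R 1 (Num.sqrt (2 * s) * a) 0 ltr01.
rewrite !mulr0 subr0 sqrtr1 invr1 !mul1r !mulr1 exprMn sqr_sqrtr ?mulr_ge0 //.
have -> : 2 * s * a ^+ 2 / 2 = s * a ^+ 2 by field.
move=> <-; last by lra.
by under [RHS]eq_integral do rewrite mul0r addr0.
Qed.

(** The linear term [dot b (Y w)] makes the induction on the family possible:
    linearizing the square of the first vector [u k] shifts [b] by a multiple of
    [u k], which does not change the products with the other vectors, and the
    remaining integral over the auxiliary variable is again a
    [normal_quadratic_mgf]. *)
Lemma gaussian_chi2_mgf (R : realType) d (T : measurableType d)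
    (P : probability T R) (n : nat) (sigma : R) (Y : T -> 'cV[R]_n)
    (I : eqType) (u : I -> 'cV[R]_n) (s : R) :
  0 < sigma -> gaussian_mgf P sigma Y -> 0 <= s < 1 / 2 ->
  forall (r : seq I) (b : 'cV[R]_n), uniq r ->
  {in r &, forall k l, dot (u k) (u l) = (k == l)%:R} ->
  (\int[P]_w (expR (s * (\sum_(k <- r) (dot (u k) (Y w) / sigma) ^+ 2)
                    + dot b (Y w)))%:E
   = (((Num.sqrt (1 - 2 * s))^-1) ^+ size r
      * expR (sigma ^+ 2 / 2 * dot b b
        + sigma ^+ 2 * s / (1 - 2 * s) * \sum_(k <- r) dot (u k) b ^+ 2))%:E)%E.
Proof.
move=> sigma0 [mY mgf] /andP[s0 s2].
have sg : sigma != 0 by rewrite gt_eqF.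
have kn : 1 - 2 * s != 0 by rewrite gt_eqF //; lra.
elim=> [|k r IH] b.
  move=> _ _; rewrite expr0 mul1r big_nil mulr0 addr0 -mgf.
  by apply: eq_integral => w _; rewrite big_nil mulr0 add0r.
move=> /= /andP[kr ur] orth.
have orthr : {in r &, forall k l, dot (u k) (u l) = (k == l)%:R}.
  by move=> x y xr yr; apply: orth; rewrite inE ?xr ?yr orbT.
have ukk : dot (u k) (u k) = 1 by rewrite orth ?inE ?eqxx.
have ukl l : l \in r -> dot (u l) (u k) = 0.
  move=> lr; rewrite orth ?inE ?eqxx ?lr ?orbT //.
  by case: eqP => // lk; rewrite lk (negbTE kr) in lr.
pose q := Num.sqrt (2 * s).
have q2 : q ^+ 2 = 2 * s by rewrite sqr_sqrtr // mulr_ge0.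
pose F (z : T * measurableTypeR R) : \bar R :=
  (expR (s * (\sum_(l <- r) (dot (u l) (Y z.1) / sigma) ^+ 2)
         + dot b (Y z.1) + q * (dot (u k) (Y z.1) / sigma) * z.2))%:E.
have mF : measurable_fun [set: T * measurableTypeR R] F.
  apply/measurable_EFinP; apply: measurableT_comp => //.
  have mdot c : measurable_fun [set: T * measurableTypeR R] (fun z => dot c (Y z.1)).
    apply: (@measurableT_comp _ _ _ _ _ _ (fun w => dot c (Y w))).
      exact: measurable_dot.
    exact: measurable_fst.
  apply: measurable_funD; first apply: measurable_funD => //.
    apply: measurable_funM => //; apply: measurable_sum => l.
    by apply: measurable_funX; apply: measurable_funM.
  apply: measurable_funM; last exact: measurable_snd.
  by apply: measurable_funM => //; apply: measurable_funM.
transitivity (\int[P]_w \int[normal_prob 0 1]_y F (w, y))%E.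
  apply: eq_integral => w _; rewrite /F /=.
  under [RHS]eq_integral do rewrite expRD EFinM.
  rewrite ge0_integralZl ?lee_fin ?expR_ge0 //.
  - rewrite gaussian_linearize // -EFinM -expRD big_cons; congr (expR _)%:E; ring.
  - apply/measurable_EFinP; apply: measurableT_comp => //; exact: mulrl_measurable.
rewrite (fubini_tonelli (m1 := P) (m2 := normal_prob 0 1) F) //; last first.
  by move=> z; rewrite lee_fin expR_ge0.
pose C := sigma ^+ 2 / 2 * dot b b +
  sigma ^+ 2 * s / (1 - 2 * s) * \sum_(l <- r) dot (u l) b ^+ 2.
transitivity (\int[normal_prob 0 1]_y
  (((Num.sqrt (1 - 2 * s))^-1 ^+ size r * expR C)%:E *
   (expR (q * sigma * dot (u k) b * y + s * (y / 1) ^+ 2))%:E))%E.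
  apply: eq_integral => y _; rewrite -EFinM -(mulrA _ (expR C)) -expRD.
  have := IH (b + (q / sigma * y) *: u k) ur orthr.
  have -> : dot (b + (q / sigma * y) *: u k) (b + (q / sigma * y) *: u k) =
    dot b b + 2 * (q / sigma * y) * dot (u k) b + (q / sigma * y) ^+ 2.
    rewrite !(dotDl, dotDr, dotZl, dotZr) ukk (dotC b (u k)); ring.
  have -> : \sum_(l <- r) dot (u l) (b + (q / sigma * y) *: u k) ^+ 2 =
            \sum_(l <- r) dot (u l) b ^+ 2.
    by apply: eq_big_seq => l lr; rewrite dotDr dotZr ukl // mulr0 addr0.
  have -> : sigma ^+ 2 / 2 * (dot b b + 2 * (q / sigma * y) * dot (u k) b +
      (q / sigma * y) ^+ 2) + sigma ^+ 2 * s / (1 - 2 * s) *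
      \sum_(l <- r) dot (u l) b ^+ 2 =
      C + (q * sigma * dot (u k) b * y + s * (y / 1) ^+ 2).
    rewrite /C !exprMn q2; field; by rewrite sg kn.
  move=> <-; apply: eq_integral => w _; rewrite /F /= dotDl dotZl.
  congr (expR _)%:E; ring.
rewrite ge0_integralZl //.
- rewrite normal_quadratic_mgf // -EFinM mulrACA -exprSr -expRD.
  congr (_ * expR _)%:E.
  rewrite /C big_cons mulr1 !exprMn q2; field; by rewrite kn.
- apply/measurable_EFinP; apply: measurableT_comp => //.
  apply: measurable_funD; first exact: mulrl_measurable.
  apply: measurable_funM => //; apply: measurable_funX; exact: mulrr_measurable.
Qed.

(** * Tail bounds *)

Lemma exp_markov (R : realType) d (T : measurableType d)
    (P : probability T R) (X : T -> R) (a : R) :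
  measurable_fun [set: T] X ->
  (P [set w | (a <= X w)%R] <= (expR (- a))%:E * \int[P]_w (expR (X w))%:E)%E.
Proof.
move=> mX; set A := [set w | a <= X w].
have mA : measurable A by exact: measurable_superlevel.
have mE : measurable_fun [set: T] (fun w => expR (- a) * expR (X w)).
  by apply: measurable_funM => //; exact: measurableT_comp.
rewrite -ge0_integralZl //; last first.
  by apply/measurable_EFinP; exact: measurableT_comp.
rewrite -[X in P X]setIT -integral_indic //; apply: ge0_le_integral => //.
- by apply/measurable_EFinP; exact: measurable_indic.
- by apply/measurable_EFinP.
move=> w _; rewrite -EFinM lee_fin -expRD indicE.
case: (boolP (w \in A)); rewrite ?expR_ge0 // inE /A /= => aX.
by rewrite -[leLHS]expR0 ler_expR addrC subr_ge0.
Qed.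

Section GaussianTails.
Context (R : realType) (d : measure_display) (T : measurableType d).
Context (P : probability T R) (n : nat) (sigma : R) (Y : T -> 'cV[R]_n).
Hypothesis sigma0 : 0 < sigma.
Hypothesis gaussY : gaussian_mgf P sigma Y.

Lemma gaussian_upper_tail (b : 'cV[R]_n) (K tau : R) :
  0 < K -> dot b b <= K -> 0 <= tau ->
  (P [set w | (tau <= dot b (Y w))%R]
    <= (expR (- (tau ^+ 2 / (2 * sigma ^+ 2 * K))))%:E)%E.
Proof.
move=> K0 bK tau0; have [mY mgf] := gaussY.
have [->|taun] := eqVneq tau 0.
  rewrite expr0n /= mul0r oppr0 expR0 probability_le1 //.
  by apply: measurable_superlevel; exact: measurable_dot.
have {tau0}tau0 : 0 < tau by rewrite lt_neqAle eq_sym taun.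
pose theta := tau / (sigma ^+ 2 * K).
have th0 : 0 < theta by rewrite divr_gt0 // mulr_gt0 // exprn_gt0.
have -> : [set w | tau <= dot b (Y w)] =
    [set w | theta * tau <= dot (theta *: b) (Y w)].
  by apply/seteqP; split => w; rewrite /= dotZl ler_pM2l.
apply: (le_trans (exp_markov _ _ (measurable_dot _ mY))).
rewrite mgf -EFinM -expRD lee_fin ler_expR.
apply: (@le_trans _ _ (- (theta * tau) + sigma ^+ 2 / 2 * (theta ^+ 2 * K))).
  rewrite lerD2l ler_wpM2l ?divr_ge0 ?sqr_ge0 // dotZl dotZr mulrA -expr2.
  by rewrite ler_wpM2l ?sqr_ge0.
rewrite le_eqVlt; apply/orP; left; apply/eqP; rewrite /theta.
by field; rewrite !gt_eqF.
Qed.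

Lemma gaussian_two_sided_tail (b : 'cV[R]_n) (K tau : R) :
  0 < K -> dot b b <= K -> 0 <= tau ->
  (P [set w | (tau <= `|dot b (Y w)|)%R]
    <= (2 * expR (- (tau ^+ 2 / (2 * sigma ^+ 2 * K))))%:E)%E.
Proof.
move=> K0 bK tau0; have [mY _] := gaussY.
have mhalf c : measurable [set w | tau <= dot c (Y w)].
  by apply: measurable_superlevel; exact: measurable_dot.
have -> : [set w | tau <= `|dot b (Y w)|] =
    [set w | tau <= dot b (Y w)] `|` [set w | tau <= dot (- b) (Y w)].
  apply/seteqP; split => w /=; rewrite dotNl ler_normr.
    by move/orP.
  by move/orP.
apply: (le_trans (measureU2 _ (mhalf _) (mhalf _))).
rewrite mulr2n mulrDl mul1r EFinD; apply: leeD; apply: gaussian_upper_tail => //.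
by rewrite dotNr dotNl opprK.
Qed.

(** Chernoff's bound with the parameter [s] for which [1 - 2 * s = a / (a + b)],
    where [a = sqrt r] and [b = sqrt (2 x)].  The moment generating function
    is then at most [expR (a * b / 2)], and
    [- s (a + b)^2 + a b / 2 = - b^2 / 2 = - x]. *)
Lemma gaussian_chi2_tail (I : eqType) (u : I -> 'cV[R]_n) (r : seq I) (x : R) :
  uniq r -> (0 < size r)%N -> 0 < x ->
  {in r &, forall k l, dot (u k) (u l) = (k == l)%:R} ->
  (P [set w | ((sigma * (Num.sqrt (2 * x) + Num.sqrt (size r)%:R)) ^+ 2
             <= \sum_(k <- r) dot (u k) (Y w) ^+ 2)%R] <= (expR (- x))%:E)%E.
Proof.
move=> ur r0 x0 orth; have [mY _] := gaussY.
set a := Num.sqrt (size r)%:R; set b := Num.sqrt (2 * x).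
have a0 : 0 < a by rewrite sqrtr_gt0 ltr0n.
have b0 : 0 < b by rewrite sqrtr_gt0 mulr_gt0.
have a2 : a ^+ 2 = (size r)%:R by rewrite sqr_sqrtr.
have b2 : b ^+ 2 = 2 * x by rewrite sqr_sqrtr // mulr_ge0 // ltW.
have ab0 : 0 < a + b by rewrite addr_gt0.
pose s := b / (a + b) / 2.
have kE : 1 - 2 * s = a / (a + b) by rewrite /s; field; rewrite gt_eqF.
have s0 : 0 < s by rewrite !divr_gt0.
have s2 : 0 <= s < 1 / 2.
  rewrite ltW //=; have : 0 < a / (a + b) by rewrite divr_gt0.
  by rewrite -kE; lra.
have -> : [set w | (sigma * (b + a)) ^+ 2 <= \sum_(k <- r) dot (u k) (Y w) ^+ 2] =
    [set w | s * (b + a) ^+ 2 <=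
       s * (\sum_(k <- r) (dot (u k) (Y w) / sigma) ^+ 2) + dot 0 (Y w)].
  apply/seteqP; split => w /=; rewrite dot0 addr0 ler_pM2l // exprMn.
    move=> H; rewrite -(ler_pM2l (exprn_gt0 2 sigma0)) (le_trans H) //.
    rewrite mulr_sumr; apply: ler_sum => k _.
    by rewrite expr_div_n mulrC divfK // gt_eqF // exprn_gt0.
  rewrite -(ler_pM2l (exprn_gt0 2 sigma0)) => /le_trans; apply.
  rewrite mulr_sumr; apply: ler_sum => k _.
  by rewrite expr_div_n mulrC divfK // gt_eqF // exprn_gt0.
apply: (le_trans (exp_markov _ _ _)).
  apply: measurable_funD; last exact: measurable_dot.
  apply: measurable_funM => //; apply: measurable_sum => k.
  by apply: measurable_funX; apply: measurable_funM => //; exact: measurable_dot.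
rewrite (gaussian_chi2_mgf sigma0 gaussY s2) //.
rewrite -EFinM lee_fin kE dot0 mulr0 add0r big1 ?mulr0 ?expR0 ?mulr1; last first.
  by move=> k _; rewrite dotC dot0 expr0n.
(* [rho <= expR (rho - 1)] for [rho = (a + b) / a = 1 + b / a]. *)
have rho : (Num.sqrt (a / (a + b)))^-1 <= expR (b / a / 2).
  rewrite -sqrtrV ?divr_ge0 ?(ltW a0) ?(ltW ab0) // invf_div.
  have -> : expR (b / a / 2) = Num.sqrt (expR (b / a / 2) ^+ 2).
    by rewrite sqrtr_sqr ger0_norm ?expR_ge0.
  apply: ler_wsqrtr; rewrite -expRM_natl (_ : 2 * _ = b / a);
    last by field; rewrite gt_eqF.
  apply: le_trans (expR_ge1Dx _).
  by rewrite mulrDl divff ?gt_eqF.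
apply: (@le_trans _ _ (expR (- (s * (b + a) ^+ 2)) * expR (b / a / 2) ^+ size r)).
  rewrite ler_wpM2l ?expR_ge0 // lerXn2r // nnegrE ?expR_ge0 //
    invr_ge0 sqrtr_ge0 //.
rewrite -expRM_natl -expRD ler_expR -a2 le_eqVlt; apply/orP; left; apply/eqP.
have -> : x = b ^+ 2 / 2 by rewrite b2 mulrC mulKf.
by rewrite /s; field; rewrite !gt_eqF.
Qed.
End GaussianTails.

Lemma union_bound (R : realType) d (T : measurableType d) (P : probability T R)
    (I : Type) (r : seq I) (Q : pred I) (A : I -> set T) (c : R) :
  (forall i, measurable (A i)) -> (forall i, Q i -> (P (A i) <= c%:E)%E) ->
  measurable (\big[setU/set0]_(i <- r | Q i) A i) /\
  (P (\big[setU/set0]_(i <- r | Q i) A i) <= (c *+ count Q r)%:E)%E.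
Proof.
move=> mA PA; elim: r => [|i r [mr Pr]].
  by rewrite big_nil measure0.
rewrite big_cons /=; case: ifPn => [Qi|//]; split; first exact: measurableU.
rewrite add1n mulrS EFinD (le_trans (measureU2 P (mA i) mr)) //.
by apply: leeD => //; exact: PA.
Qed.

Lemma edges_le_sqr n m (G : digraph n m) : (m <= n ^ 2)%N.
Proof.
have := leq_card _ (edge_inj (d := G)).
by rewrite card_prod !card_ord mulnn.
Qed.

(** The variance proxy [N / 4] makes the exponent [2 * L] with
    [L = ln (2 n) + t], where [L] would suffice for [n] edges.  So the union bound
    can afford the crude count [n ^ 2] of the edges, which is immediate from the
    injectivity of the edge map. *)
Lemma edge_noise_tail (R : realType) (n m : nat) (N sigma t tau : R) :
  (0 < n)%N -> (m <= n ^ 2)%N -> 0 < sigma -> 0 < t -> 0 < N ->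
  sigma * Num.sqrt (N * (ln (2 * n%:R) + t)) <= tau ->
  (2 * expR (- (tau ^+ 2 / (2 * sigma ^+ 2 * (N / 4))))) *+ m <= expR (- t).
Proof.
move=> n0 mn s0 t0 N0 htau.
have n0' : 0 < n%:R :> R by rewrite ltr0n.
have n1' : 1 <= n%:R :> R by rewrite ler1n.
set L := ln (2 * n%:R) + t.
have L0 : 0 < L by rewrite ltr_wpDl // ln_ge0 //; lra.
have tau2 : sigma ^+ 2 * (N * L) <= tau ^+ 2.
  rewrite -(sqr_sqrtr (ltW (mulr_gt0 N0 L0))) -exprMn ler_sqr // nnegrE.
    by rewrite mulr_ge0 ?sqrtr_ge0 // ltW.
  by rewrite (le_trans _ htau) // mulr_ge0 ?sqrtr_ge0 // ltW.
(* [2 n^2 exp (- 2 L) = exp (- t)^2 / 2]. *)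
apply: (@le_trans _ _ ((2 * expR (- (2 * L))) *+ (n ^ 2))).
  apply: (@le_trans _ _ ((2 * expR (- (2 * L))) *+ m)).
    rewrite lerMn2r; apply/orP; right.
    rewrite ler_pM2l // ler_expR lerN2 ler_pdivlMr; last first.
      by rewrite !mulr_gt0 // ?exprn_gt0 // invr_gt0.
    by rewrite (le_trans _ tau2) // le_eqVlt; apply/orP; left; apply/eqP; field.
  by rewrite ler_pMn2l // mulr_gt0 // expR_gt0.
have -> : expR (- (2 * L)) = (2 * n%:R) ^- 2 * expR (- t) ^+ 2.
  rewrite expRN mulrC expRM_natr /L expRD lnK ?posrE ?mulr_gt0 //.
  by rewrite exprMn invfM expRN exprVn.
rewrite -mulr_natr natrX exprMn.
rewrite (_ : _ * _ = expR (- t) ^+ 2 / 2); last by field; rewrite gt_eqF.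
have e0 := expR_gt0 (- t).
have e1 : expR (- t) <= 1 by rewrite -[leRHS]expR0 ler_expR oppr_le0 ltW.
nra.
Qed.

Lemma n_max_gt0 n m (G : digraph n m) S : (0 < n)%N -> (0 < n_max G S)%N.
Proof.
move=> n0; apply: leq_trans (card_component_le G S (Ordinal n0)).
by rewrite card_gt0; apply/set0Pn; exists (Ordinal n0); rewrite finset.inE connect0.
Qed.

(** * The oracle inequality *)

Unset Implicit Arguments.

(* At lambda = sigma sqrt(n_max (log(2n) + t)) / n the last term is
   4 (sigma / n) sqrt(n_max (log(2n) + t)) ||D f||_1.  For larger lambda the
   factor has to be lambda itself: when lambda grows, fhat tends to the
   constant vector of the mean of Y, so with the smaller factor the inequality
   fails for n = 2, f = f0 = (0, M), M large. *)
Theorem corollary4p8 (R : realType) (d : measure_display)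
    (T : measurableType d) (P : probability T R)
    (n m : nat) (G : digraph n m)
    (f0 : 'cV[R]_n) (sigma : R) (eps : 'I_n -> {RV P >-> R})
    (S : {set 'I_m}) (x t lambda : R) (fhat : T -> 'cV[R]_n) (f : 'cV[R]_n) :
  let D := incidence R G in
  let nmax := (n_max G S)%:R : R in
  let rS := (r_S D S)%:R : R in
  0 < sigma -> white_noise eps sigma ->
  tree_graph G \/ (cycle_graph G /\ S != finset.set0) ->
  is_support D S ->
  0 < x -> 0 < t ->
  0 < lambda ->
  sigma * Num.sqrt (nmax * (ln (2 * n%:R) + t)) / n%:R <= lambda ->
  (forall w, tv_argmin D lambda (observation f0 eps w) (fhat w)) ->
  ((1 - expR (- x) - expR (- t))%:E <=
   P [set w | (sqnorm_n (fhat w - f0) <=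
               sqnorm_n (f - f0)
               + sigma ^+ 2 / n%:R * (Num.sqrt (2 * x) + Num.sqrt rS) ^+ 2
               + 4 * lambda * norm1 (D *m f))%R])%E.
Proof.
move=> D nmax rS sigma0 wn treecyc _ x0 t0 l0 hl opt.
have n0 : (0 < n)%N.
  case: treecyc => [[_ ->] //|[_ /set0Pn[s _]]].
  exact: leq_ltn_trans (ltn_ord (G s).1).
have n0' : 0 < n%:R :> R by rewrite ltr0n.
have ind : independent_edges R G S.
  case: treecyc => [tr|[cyc S0]]; first exact: tree_independent_edges.
  exact: cycle_independent_edges.
have [z [z_norm z_dec]] := component_edge_decomposition ind.
have N0 : 0 < nmax by rewrite ltr0n n_max_gt0.
have gaussY := white_noise_mgf sigma0 wn.
set Y := fun w => \col_i eps i w in gaussY.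
have mY := gaussY.1.
pose comps := components G S.
pose u := @component_vector R n.
have orth : {in comps &, forall C C', dot (u C) (u C') = (C == C')%:R}.
  exact: component_orthonormal.
pose b := Num.sqrt (2 * x).
pose bad1 := [set w | (sigma * (b + Num.sqrt #|comps|%:R)) ^+ 2
  <= \sum_(C in comps) dot (u C) (Y w) ^+ 2].
pose bad2 := \big[setU/set0]_(j <- enum 'I_m | j \notin S)
  [set w | n%:R * lambda <= `|dot (z j) (Y w)|].
have mdot a : measurable_fun [set: T] (fun w => dot a (Y w)).
  exact: measurable_dot.
have [mbad1 Pbad1] : measurable bad1 /\ (P bad1 <= (expR (- x))%:E)%E.
  split.
    apply: measurable_superlevel.
    rewrite [X in measurable_fun _ X](_ : _ =
      (fun w => \sum_(C <- enum comps) dot (u C) (Y w) ^+ 2)); last first.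
      by apply/funext => w; rewrite big_enum.
    by apply: measurable_sum => C; exact: measurable_funX.
  have := @gaussian_chi2_tail R d T P n sigma Y sigma0 gaussY _ u (enum comps) x
    (enum_uniq _) _ x0.
  rewrite -cardE => /(_ (components_gt0 _ _ n0)).
  rewrite /bad1; under eq_set do rewrite big_enum.
  apply=> k l; rewrite !mem_enum; exact: orth.
have [mbad2 Pbad2] : measurable bad2 /\ (P bad2 <= (expR (- t))%:E)%E.
  have := @union_bound R d T P _ (enum 'I_m) (fun j => j \notin S)
    (fun j => [set w | n%:R * lambda <= `|dot (z j) (Y w)|])
    (2 * expR (- ((n%:R * lambda) ^+ 2 / (2 * sigma ^+ 2 * (nmax / 4))))).
  case=> [j|j jS|mb2 Pb2].
  - by apply: measurable_superlevel; exact: measurableT_comp.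
  - apply: gaussian_two_sided_tail => //; first by rewrite divr_gt0.
      exact: z_norm.
    by rewrite mulr_ge0 // ltW.
  split=> //; apply: (le_trans Pb2); rewrite lee_fin.
  apply: (@edge_noise_tail R n _ nmax sigma t) => //.
    by rewrite (leq_trans (count_size _ _)) // size_enum_ord; exact: (edges_le_sqr G).
  by rewrite [leRHS]mulrC -ler_pdivrMr.
pose q := (sigma * (b + Num.sqrt #|comps|%:R)) ^+ 2.
set good := [set w | _].
have subgood : ~` (bad1 `|` bad2) `<=` good.
  move=> w /not_orP[nb1 nb2].
  have := @tv_oracle_inequality R n m D lambda l0 _ comps u S z f0 (Y w) (fhat w)
    f q n0 orth z_dec (opt w).
  have E : \sum_(C in comps) dot (u C) (Y w) ^+ 2 <= q.
    by apply: ltW; rewrite ltNge; apply/negP.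
  move=> /(_ E) H; rewrite /good /=; apply: le_trans (H _) _ => [j jS|].
    apply: ltW; rewrite ltNge; apply/negP => jbad; apply: nb2.
    by rewrite /bad2 -bigcup_seq_cond; exists j => //=; rewrite mem_enum jS.
  rewrite lerD2r lerD2l [leRHS]mulrAC ler_pM2r ?invr_gt0 // /q exprMn.
  rewrite ler_pM2l ?exprn_gt0 // ler_sqr ?nnegrE ?addr_ge0 ?sqrtr_ge0 //.
  rewrite lerD2l; apply: ler_wsqrtr; rewrite ler_nat.
  exact: card_components_le.
have mgood : measurable good.
  have mfhat := tv_argmin_measurable n0 l0 _ opt.
  have mobs i : measurable_fun [set: T] (fun w => observation f0 eps w i 0).
    by under eq_fun do rewrite !mxE; apply: measurable_funD.
  have msq : measurable_fun [set: T] (fun w => sqnorm_n (fhat w - f0)).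
    apply: measurable_funM => //; apply: measurable_sum => i.
    apply: measurable_funX; under eq_fun do rewrite !mxE.
    by apply: measurable_funB => //; exact: mfhat.
  have sublevel c : measurable [set w | sqnorm_n (fhat w - f0) <= c].
    rewrite (_ : [set w | _] = [set w | - c <= - sqnorm_n (fhat w - f0)]).
      by apply: measurable_superlevel; exact: measurableT_comp.
    by apply/seteqP; split => w; rewrite /= lerN2.
  exact: sublevel.
have mbad : measurable (bad1 `|` bad2) by exact: measurableU.
apply: (@le_trans _ _ (P (~` (bad1 `|` bad2)))); last first.
  by apply: le_measure; rewrite ?inE //; exact: measurableC.
rewrite probability_setC // !EFinB -addeA leeD2l // -oppeD // leeN2.
by rewrite (le_trans (measureU2 P mbad1 mbad2)) // leeD.
Qed.
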